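(* Consider the data-driven robust unit commitment setting described in the context, with $\varepsilon,\delta\in(0,1)$. Select two disjoint groups from the forecast-error data $e_1,\dots,e_N$, with realizations $e_{1}^{(1)},\dots,e_{N_1}^{(1)}$ and $e_{1}^{(2)},\dots,e_{N_2}^{(2)}$, where $N_1 + N_2 \leq N$ and $N_2 \geq \log_{1 - \varepsilon} \delta$. Let $$\mu := \frac{1}{N_1} \sum_{n = 1}^{N_1} e_n^{(1)},\qquad \Sigma := \frac{1}{N_1 - 1} \sum_{n = 1}^{N_1} ( e_n^{(1)} - \mu ) ( e_n^{(1)} - \mu )^\top,$$ and assume $\Sigma$ is invertible. Define $a(e) := (e - \mu)^\top \Sigma^{-1} (e - \mu)$. For a positive integer $K$ let $$n_K^* := \min \Big\{ n \in \mathbb{N} ~\Big|~ \sum_{m = 0}^{n - 1} \binom{K}{m} (1 - \varepsilon)^m \varepsilon^{K - m} \geq 1 - \delta \Big\}.$$ Let $\alpha$ be the $n_{N_2}^*$-th smallest value among $a(e_1^{(2)}), \dots, a(e_{N_2}^{(2)})$, and define $\mathcal{E} := \{ e ~|~ (e - \mu)^\top \Sigma^{-1} (e - \mu) \leq \alpha \}$. Then $$\mathbb{P}^N\big[\Pr[e \in \mathcal{E}] \geq 1 - \varepsilon\big] \geq 1 - \delta .$$ Moreover, if $\mathcal{U}_1 := \{ u \in \mathcal{U}_0 ~|~ u - \hat{u} \in \mathcal{E} \}$ is used as the uncertainty set $\mathcal U$ in the robust problem defining $O_{\mathcal U}$ and $x_0$ is an optimal solution of that problem, then $$\mathbb{P}^N[O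 \leq O_{x_0} \leq O_{\mathcal{U}_1}] \geq 1 - \delta.$$
   Context: The uncertain load vector is $u=\hat u+e$, where $\hat u$ is a fixed prediction and the forecast error $e$ is a continuous random vector with distribution $\mathbb P$. The historical forecast errors $e_1,\dots,e_N$ are i.i.d. with distribution $\mathbb P$ (independent of the new error $e$); $\mathbb P^N$ denotes their joint distribution (so sets built from the data are random), and $\Pr$ refers to the distribution of the new $e$ (equivalently $u$). $\mathcal U_0=\{u\mid \underline U\le u\le \overline U\}$ is a set with $\Pr[u\in\mathcal U_0]=1$. The robust unit commitment problem has the compact form: for an uncertainty set $\mathcal U$, $$O_{\mathcal{U}} := \min_{x \in \mathcal{X}} \Big\{ C^\top x + \max_{u \in \mathcal{U}} \min_{y:\, A y \geq B x + D u + E} F^\top y \Big\},$$ where $\mathcal X$ is the (mixed-integer linear) pre-dispatch feasible set of unit commitment and $A,B,C,D,E,F$ are given coefficient matrices/vectors; write $f(x)=C^\top x$, $h(y)=F^\top y$, $\mathcal Y(x,u)=\{y: Ay\ge Bx+Du+E\}$, with minimum over an empty set equal to $+\infty$. The chance-constrained problem has value $O := \min_{x \in \mathcal{X}, \eta}\{ f(x) + \eta : \Pr[ \min_{y \in \mathcal{Y}(x, u)} h(y) \leq \eta ] \geq 1 - \varepsilon\}$, and for $x\in\mathcal X$, $O_x := f(x) + \min \{ \eta \mid \Pr [ \min_{y \in \mathcal{Y}(x, u)} h(y) \leq \eta ] \geq 1 - \varepsilon \}$. Optimal solutions of these problems are assumed to exist. *)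

(* Defs.v *)
From HB Require Import structures.
From mathcomp Require Import all_boot all_order all_algebra.
From mathcomp Require Import all_classical all_reals all_analysis.
Set Implicit Arguments. Unset Strict Implicit. Unset Printing Implicit Defensive.
Import Order.TTheory GRing.Theory Num.Theory.
Import numFieldNormedType.Exports.
Local Open Scope classical_set_scope.
Local Open Scope ring_scope.

Definition vopen (R : realType) (d : nat) : set (set 'cV[R]_d) := [set A | open A].
Definition borelV (R : realType) (d : nat) := g_sigma_algebraType (@vopen R d).

Definition smean (R : realType) d n (v : 'I_n -> 'cV[R]_d) : 'cV[R]_d :=
  n%:R^-1 *: \sum_(i < n) v i.
Definition scov (R : realType) d n (v : 'I_n -> 'cV[R]_d) : 'M[R]_d :=
  (n%:R - 1)^-1 *: \sum_(i < n) ((v i - smean v) *m (v i - smean v)^T).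
Definition mahal (R : realType) d (mu : 'cV[R]_d) (S : 'M[R]_d) (e : 'cV[R]_d) : R :=
  ((e - mu)^T *m invmx S *m (e - mu)) 0 0.
Definition ellipsoid (R : realType) d (mu : 'cV[R]_d) (S : 'M[R]_d) (alpha : R)
  : set 'cV[R]_d := [set e | mahal mu S e <= alpha].

Definition binom_sum (R : realType) (K : nat) (eps : R) (n : nat) : R :=
  \sum_(m < n) ('C(K, m))%:R * (1 - eps) ^+ m * eps ^+ (K - m).
Definition is_min_nat (P : nat -> Prop) (n : nat) : Prop :=
  P n /\ forall m, P m -> (n <= m)%N.
Definition kth_smallest (R : realType) (s : seq R) (k : nat) : R :=
  nth 0 (sort <=%R s) k.-1.

Definition colge (R : realType) r (v w : 'cV[R]_r) : Prop := forall i, w i 0 <= v i 0.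

Definition milp_set (R : realType) p s (G : 'M[R]_(s, p)) (g : 'cV[R]_s)
  (J : set 'I_p) : set 'cV[R]_p :=
  [set x | colge (G *m x) g /\ forall j, J j -> x j 0 \is a Num.int].

Definition box (R : realType) d (Ulo Uhi : 'cV[R]_d) : set 'cV[R]_d :=
  [set u | colge u Ulo /\ colge Uhi u].

Definition Yset (R : realType) p q d r (A : 'M[R]_(r, q)) (B : 'M[R]_(r, p))
  (D : 'M[R]_(r, d)) (E : 'cV[R]_r) (x : 'cV[R]_p) (u : 'cV[R]_d) : set 'cV[R]_q :=
  [set y | colge (A *m y) (B *m x + D *m u + E)].

(* second stage value  min_{y in Y(x,u)} F^T y  (= +oo on an empty set) *)
Definition Qval (R : realType) p q d r (A : 'M[R]_(r, q)) (B : 'M[R]_(r, p))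
  (D : 'M[R]_(r, d)) (E : 'cV[R]_r) (F : 'cV[R]_q) (x : 'cV[R]_p) (u : 'cV[R]_d)
  : \bar R :=
  ereal_inf [set ((F^T *m y) 0 0)%:E | y in Yset A B D E x u].

Definition fcost (R : realType) p (C : 'cV[R]_p) (x : 'cV[R]_p) : R := (C^T *m x) 0 0.

Definition O_rob (R : realType) p q d r (X : set 'cV[R]_p) (A : 'M[R]_(r, q))
  (B : 'M[R]_(r, p)) (C : 'cV[R]_p) (D : 'M[R]_(r, d)) (E : 'cV[R]_r)
  (F : 'cV[R]_q) (U : set 'cV[R]_d) : \bar R :=
  ereal_inf [set ((fcost C x)%:E + ereal_sup [set Qval A B D E F x u | u in U])%E
            | x in X].

Definition chance_ok (R : realType) p q d r (A : 'M[R]_(r, q)) (B : 'M[R]_(r, p))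
  (D : 'M[R]_(r, d)) (E : 'cV[R]_r) (F : 'cV[R]_q) (uhat : 'cV[R]_d)
  (P : probability (borelV R d) R) (eps : R) (x : 'cV[R]_p) (eta : R) : Prop :=
  (P [set e : 'cV[R]_d | (Qval A B D E F x (uhat + e) <= eta%:E)%E]
     >= (1 - eps)%:E)%E.

Definition O_cc (R : realType) p q d r (X : set 'cV[R]_p) (A : 'M[R]_(r, q))
  (B : 'M[R]_(r, p)) (C : 'cV[R]_p) (D : 'M[R]_(r, d)) (E : 'cV[R]_r)
  (F : 'cV[R]_q) (uhat : 'cV[R]_d) (P : probability (borelV R d) R) (eps : R)
  : \bar R :=
  ereal_inf [set z | exists x eta, X x /\ chance_ok A B D E F uhat P eps x eta
                                   /\ z = (fcost C x + eta)%:E].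

Definition O_x (R : realType) p q d r (A : 'M[R]_(r, q))
  (B : 'M[R]_(r, p)) (C : 'cV[R]_p) (D : 'M[R]_(r, d)) (E : 'cV[R]_r)
  (F : 'cV[R]_q) (uhat : 'cV[R]_d) (P : probability (borelV R d) R) (eps : R)
  (x : 'cV[R]_p) : \bar R :=
  ((fcost C x)%:E
   + ereal_inf [set eta%:E | eta in [set eta | chance_ok A B D E F uhat P eps x eta]])%E.

Definition iid_with (R : realType) (d0 : measure_display) (Omega : measurableType d0)
  (Qm : probability Omega R) d N (e : 'I_N -> Omega -> 'cV[R]_d)
  (P : probability (borelV R d) R) : Prop :=
  (forall i, measurable_fun setT (e i : Omega -> borelV R d)) /\
  (forall i (Bs : set (borelV R d)), measurable Bs -> Qm (e i @^-1` Bs) = P Bs) /\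
  (forall Bs : 'I_N -> set (borelV R d), (forall i, measurable (Bs i)) ->
     Qm (\bigcap_(i in [set: 'I_N]) (e i @^-1` Bs i)) = (\prod_(i < N) Qm (e i @^-1` Bs i))%E).

(* Main.v *)
Require Import Defs.
From HB Require Import structures.
From mathcomp Require Import all_boot all_order all_algebra.
From mathcomp Require Import all_classical all_reals all_analysis.
From mathcomp Require Import measurable_realfun ring lra.
Import Order.TTheory GRing.Theory Num.Theory.
Import numFieldNormedType.Exports.
Local Open Scope classical_set_scope.
Local Open Scope ring_scope.
Set Implicit Arguments.
Unset Strict Implicit.
Unset Printing Implicit Defensive.

(* Fix the first group, hence the score a = mahal mu Sigma, and call a point x of
   the second group low when P(a <= a x) < 1 - eps.  If fewer than k points of
   the second group are low, the ellipsoid through the k-th smallest score has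
   probability at least 1 - eps.  Even when a has atoms, the set of low points has
   P-probability at most 1 - eps; so, adding the points of the second group one
   at a time, each new one is not low with conditional probability at least eps
   given everything seen before, and Pascal's rule yields the lower bound
   binom_sum N2 eps k >= 1 - delta for the probability that fewer than k are low.
   When the ellipsoid E has probability at least 1 - eps, the worst case of the
   second stage over U_1 is a feasible eta in the chance constraint at x_0. *)

(** * Measurability of matrix-valued maps, up to the Mahalanobis score *)

Section mx_measurable.
Context d0 (T : measurableType d0) (R : realType).

(** Stated entry by entry so that every matrix operation reduces to real arithmetic;
    [mx_measurableP] derives it from Borel measurability of column vectors. *)
Definition mx_measurable m n (M : T -> 'M[R]_(m, n)) :=
  forall i j, measurable_fun setT (fun t => M t i j).

Lemma mx_measurableB m n (M N : T -> 'M[R]_(m, n)) :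
  mx_measurable M -> mx_measurable N -> mx_measurable (fun t => M t - N t).
Proof.
move=> mM mN i j; under eq_fun do rewrite !mxE.
exact: measurable_funB.
Qed.

Lemma mx_measurable_sum m n I (s : seq I) (M : I -> T -> 'M[R]_(m, n)) :
  (forall k, mx_measurable (M k)) -> mx_measurable (fun t => \sum_(k <- s) M k t).
Proof.
move=> mM i j; under eq_fun do rewrite summxE.
by apply: measurable_sum => k; exact: mM.
Qed.

Lemma mx_measurableZ m n (f : T -> R) (M : T -> 'M[R]_(m, n)) :
  measurable_fun setT f -> mx_measurable M -> mx_measurable (fun t => f t *: M t).
Proof.
move=> mf mM i j; under eq_fun do rewrite !mxE.
exact: measurable_funM.
Qed.

Lemma mx_measurable_tr m n (M : T -> 'M[R]_(m, n)) :
  mx_measurable M -> mx_measurable (fun t => (M t)^T).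
Proof. by move=> mM i j; under eq_fun do rewrite mxE; exact: mM. Qed.

Lemma mx_measurable_mul m n q (M : T -> 'M[R]_(m, n)) (N : T -> 'M[R]_(n, q)) :
  mx_measurable M -> mx_measurable N -> mx_measurable (fun t => M t *m N t).
Proof.
move=> mM mN i j; under eq_fun do rewrite mxE.
by apply: measurable_sum => k; apply: measurable_funM; [exact: mM|exact: mN].
Qed.

Lemma measurable_det n (M : T -> 'M[R]_n) :
  mx_measurable M -> measurable_fun setT (fun t => \det (M t)).
Proof.
move=> mM; apply: measurable_sum => s; apply: measurable_funM => //.
by apply: measurable_prod => i _; exact: mM.
Qed.

(** Writes 1/f as f times a real power of f^2, so that measurability of [powR] applies. Since the
    inverse of 0 is 0, the identity also holds where f vanishes. *)
Lemma measurable_inv (f : T -> R) :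
  measurable_fun setT f -> measurable_fun setT (fun t => (f t)^-1).
Proof.
move=> mf.
have -> : (fun t => (f t)^-1) = (fun t => f t * ((f t ^+ 2) `^ (-1))).
  apply/funext => t; rewrite powR_inv1 ?sqr_ge0// expr2.
  have [->|f0] := eqVneq (f t) 0; first by rewrite invr0 mul0r.
  by rewrite invfM mulrA divff// mul1r.
apply: measurable_funM => //.
apply: (measurableT_comp (f := fun x : R => x `^ (-1))); first exact: measurable_powR.
exact: measurable_funX.
Qed.

(** [invmx] returns the matrix itself when the determinant is 0 and the adjugate over the
    determinant otherwise; the test and both branches are measurable. *)
Lemma mx_measurable_inv n (M : T -> 'M[R]_n) :
  mx_measurable M -> mx_measurable (fun t => invmx (M t)).
Proof.
move=> mM i j.
have -> : (fun t => invmx (M t) i j) = (fun t => if \det (M t) == 0 then M t i j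
   else ((\det (M t))^-1 *: \adj (M t)) i j).
  apply/funext => t; rewrite /invmx unitmxE unitfE.
  by case: (_ == _).
apply: measurable_fun_ifT => //; last first.
- move: i j; apply: mx_measurableZ; first exact/measurable_inv/measurable_det.
  move=> i j; under eq_fun do rewrite mxE /cofactor.
  apply: measurable_funM => //.
  by apply: measurable_det => k l; under eq_fun do rewrite !mxE; exact: mM.
- by apply: measurable_fun_eqr => //; exact: measurable_det.
Qed.

Lemma mx_measurable_smean d n (v : 'I_n -> T -> 'cV[R]_d) :
  (forall k, mx_measurable (v k)) -> mx_measurable (fun t => smean (fun k => v k t)).
Proof. by move=> mv; apply: mx_measurableZ => //; exact: mx_measurable_sum. Qed.

Lemma mx_measurable_scov d n (v : 'I_n -> T -> 'cV[R]_d) :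
  (forall k, mx_measurable (v k)) -> mx_measurable (fun t => scov (fun k => v k t)).
Proof.
move=> mv; apply: mx_measurableZ => //; apply: mx_measurable_sum => k.
have mB : mx_measurable (fun t => v k t - smean (fun k => v k t)).
  by apply: mx_measurableB => //; exact: mx_measurable_smean.
by apply: mx_measurable_mul => //; exact: mx_measurable_tr.
Qed.

Lemma measurable_mahal d (mu : T -> 'cV[R]_d) (S : T -> 'M[R]_d) (x : T -> 'cV[R]_d) :
  mx_measurable mu -> mx_measurable S -> mx_measurable x ->
  measurable_fun setT (fun t => mahal (mu t) (S t) (x t)).
Proof.
move=> mmu mS mx.
have mB : mx_measurable (fun t => x t - mu t) by exact: mx_measurableB.
suff : mx_measurable (fun t => (x t - mu t)^T *m invmx (S t) *m (x t - mu t)).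
  exact.
by do 2?apply: mx_measurable_mul => //; [exact: mx_measurable_tr|exact: mx_measurable_inv].
Qed.

(** Coordinates are continuous, so they pull open intervals back to generators of the sigma-algebra
    of [borelV]. *)
Lemma mx_measurableP d (x : T -> borelV R d) :
  measurable_fun setT x -> mx_measurable (x : T -> 'cV[R]_d).
Proof.
move=> mx i j.
have mc : measurable_fun (setT : set (borelV R d)) (fun v : 'cV[R]_d => v i j).
  refine (@measurability _ _ (borelV R d) R setT (fun v : 'cV[R]_d => v i j) (@RGenOpens.G R) (RGenOpens.measurableE R) _).
  move=> _ [_ [a [b ->]] <-]; rewrite setTI; apply: sub_sigma_algebra => /=.
  by apply: open_comp => [v _|]; [exact: coord_continuous|exact: interval_open].
exact: (measurableT_comp mc mx).
Qed.
End mx_measurable.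

(** * Binomial partial sums and the tail bound *)

(** Conditions on one trial, [binom_sum K eps k] being the probability of fewer than [k] successes
    in [K] trials of success probability [1 - eps]. At [k = 0] the predecessor is 0 and all the sums
    are empty. *)
Lemma binom_sumS (R : realType) (K : nat) (eps : R) k :
  binom_sum K.+1 eps k = (1 - eps) * binom_sum K eps k.-1 + eps * binom_sum K eps k.
Proof.
have E0 n : binom_sum n eps 0 = 0 by rewrite /binom_sum big_ord0.
case: k => [|k] /=; first by rewrite !E0 !mulr0 addr0.
rewrite /binom_sum !mulr_sumr big_ord_recl [X in _ = _ + X]big_ord_recl /=.
rewrite !bin0 !expr0 !subn0 !mul1r -exprS [RHS]addrCA; congr (_ + _).
rewrite -big_split /=; apply: eq_bigr => i _.
rewrite /bump /= !add1n binS natrD subSS.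
have [iK|Ki] := leqP i.+1 K.
  by rewrite -(subnSK iK) !exprS; ring.
by rewrite (bin_small Ki) exprS; ring.
Qed.

(** Only the term [m = K] is missing from the expansion of [(eps + (1 - eps)) ^+ K]. *)
Lemma binom_sum_full (R : realType) (K : nat) (eps : R) :
  binom_sum K eps K = 1 - (1 - eps) ^+ K.
Proof.
have : (eps + (1 - eps)) ^+ K = binom_sum K eps K + (1 - eps) ^+ K.
  rewrite exprDn big_ord_recr /= subnn expr0 mul1r binn mulr1n; congr (_ + _).
  by apply: eq_bigr => i _; rewrite -mulr_natl mulrA mulrAC -mulrA [X in _ * X]mulrC mulrA.
by rewrite addrC subrK expr1n => /eqP; rewrite -subr_eq => /eqP <-.
Qed.

Section binomial_tail.
Local Open Scope ereal_scope.
Context d0 (Omega : measurableType d0) (R : realType) (Q : probability Omega R).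
Context (I : eqType) (Bd : I -> set Omega).

Definition occurrences (s : seq I) (w : Omega) : nat :=
  count (fun j => `[< Bd j w >]) s.

Lemma measurable_occurrences (s : seq I) :
  {in s, forall j, measurable (Bd j)} -> measurable_fun setT (occurrences s).
Proof.
elim: s => [_|j s IH mBd]; first exact: measurable_cst.
rewrite (_ : occurrences _ = fun w => (if `[< Bd j w >] then (occurrences s w).+1 else occurrences s w)); last first.
  by apply/funext => w; rewrite /occurrences /=; case: `[< _ >].
have ms : measurable_fun setT (occurrences s).
  by apply: IH => i si; apply: mBd; rewrite inE si orbT.
apply: measurable_fun_ifT => //; last first.
  exact: (@measurableT_comp _ _ _ _ _ _ succn).
apply: (measurable_fun_bool true); rewrite setTI.
rewrite (_ : _ @^-1` _ = Bd j); first by apply: mBd; rewrite inE eqxx.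
by apply/seteqP; split => w /= => [/asboolP|/asboolP].
Qed.

(** Induction on [s]: if fewer than [k] events occurred, one more index keeps the count below
    [k.+1]; if exactly [k] occurred, it does so precisely off [Bd j], hence with conditional
    probability at least [eps]. The bound thus follows the recurrence of [binom_sumS]. *)
Lemma binomial_tail (eps : R) :
    (forall j, measurable (Bd j)) ->
    (0 <= eps <= 1)%R ->
    (forall j s k, j \notin s -> eps%:E * Q [set w | occurrences s w = k]
       <= Q ([set w | occurrences s w = k] `&` ~` Bd j)) ->
  forall s k, uniq s ->
    (binom_sum (size s) eps k)%:E <= Q [set w | (occurrences s w < k)%N].
Proof.
move=> mBd /andP[eps0 eps1] ind; elim => [|j s IH] k /=.
  move=> _; case: k => [|k]; first by rewrite /binom_sum big_ord0.
  rewrite [X in Q X](_ : _ = setT); last by apply/seteqP; split.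
  rewrite probability_setT lee_fin /binom_sum big_ord_recl /= !expr0 bin0 !mulr1.
  by rewrite big1 ?addr0// => i _; rewrite bin0n /= !mul0r.
move=> /andP[js us].
case: k => [|k]; first by rewrite /binom_sum big_ord0.
have ml (A : set nat) : measurable (occurrences s @^-1` A).
  by rewrite -[X in measurable X]setTI; apply: measurable_occurrences => // i _.
pose L := [set w | (occurrences s w < k)%N].
pose M := [set w | occurrences s w = k].
have mL : measurable L by exact: (ml [set n | (n < k)%N]).
have mM : measurable M by exact: (ml [set k]).
have -> : [set w | (occurrences (j :: s) w < k.+1)%N] = L `|` (M `&` ~` Bd j).
  apply/seteqP; split => w; rewrite /L /M /occurrences /=; case: asboolP => /= Bw.
  - by rewrite add1n ltnS; left.
  - rewrite add0n ltnS leq_eqVlt => /orP[/eqP|]; [by right|by left].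
  - by case=> [|[]//]; rewrite add1n ltnS.
  - by rewrite add0n ltnS => -[/ltnW|[-> _]].
have LM : L `&` M = set0.
  by apply/seteqP; split => w // []; rewrite /L /M /= => + kE; rewrite kE ltnn.
have mMB : measurable (M `&` ~` Bd j) by apply: measurableI => //; exact: measurableC.
rewrite measureU //; last by rewrite setIA LM set0I.
have := ind j s k js; rewrite -/M => indM.
have QLM : Q [set w | (occurrences s w < k.+1)%N] = Q L + Q M.
  rewrite -measureU //; congr (Q _); apply/seteqP; split => w; rewrite /L /M /=.
    by rewrite ltnS leq_eqVlt => /orP[/eqP|]; [right|left].
  by case=> [|->//]; exact: ltnW.
have [a aE] : exists a, Q L = a%:E.
  by exists (fine (Q L)); rewrite fineK// fin_num_measure.
have [b bE] : exists b, Q M = b%:E.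
  by exists (fine (Q M)); rewrite fineK// fin_num_measure.
have := IH k us; have := IH k.+1 us.
rewrite QLM -/L => hS h0.
apply: (@le_trans _ _ (Q L + eps%:E * Q M)); last exact: leeD2l.
move: hS h0; rewrite binom_sumS aE bE. rewrite -EFinD -EFinM -EFinD !lee_fin => hS h0.
(* This convex combination matches [binom_sumS]: the induction hypothesis at [k] bounds [a], and at
   [k.+1] it bounds [a + b]. *)
have -> : (a + eps * b = (1 - eps) * a + eps * (a + b))%R by ring.
by rewrite lerD// ler_wpM2l// subr_ge0.
Qed.
End binomial_tail.

(** * Points whose sublevel set has small mass *)

Lemma measurable_sublevel d0 (V : measurableType d0) (R : realType) (f : V -> R) t :
  measurable_fun setT f -> measurable [set y | f y <= t].
Proof.
move=> mf; rewrite (_ : [set _ | _] = f @^-1` `]-oo, t]%classic).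
  by rewrite -[X in measurable X]setTI; exact: mf.
by apply/seteqP; split => y; rewrite /= in_itv.
Qed.

Section below_level.
Local Open Scope ereal_scope.
Context d0 (V : measurableType d0) (R : realType) (P : probability V R).

(* The levels of mass [< c] form a lower set, exhausted by a monotone sequence. *)
Lemma probability_below_level (f : V -> R) (c : R) :
  measurable_fun setT f -> (0 <= c)%R ->
  P [set x | P [set y | (f y <= f x)%R] < c%:E] <= c%:E.
Proof.
move=> mf c0.
have ml t := measurable_sublevel t mf.
pose I := [set t | P [set y | (f y <= t)%R] < c%:E].
have Idown s t : (s <= t)%R -> I t -> I s.
  move=> st; apply: le_lt_trans; apply: le_measure; rewrite ?inE//.
  by move=> y /= /le_trans; exact.
have [->|/set0P I0] := eqVneq [set x | P [set y | (f y <= f x)%R] < c%:E] set0.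
  by rewrite measure0 lee_fin.
have {}I0 : I !=set0 by have [x Ix] := I0; exists (f x).
(* A nondecreasing cofinal sequence in [I]: constant at the maximum if there is one, the naturals if
   [I] is unbounded above, and otherwise the levels 1/(n+1) below the supremum. *)
have [u [Iu ndu uI]] : exists u : nat -> R,
    [/\ forall n, I (u n), nondecreasing_seq u & forall s, I s -> exists n, (s <= u n)%R].
  have [[M [IM maxM]]|nomax] := pselect (exists M, I M /\ forall s, I s -> (s <= M)%R).
    by exists (fun=> M); split => // s Is; exists 0%N; exact: maxM.
  have gtI s : I s -> exists2 t, I t & (s < t)%R.
    move=> Is; apply: contrapT => h; apply: nomax; exists s; split => // t It.
    by rewrite leNgt; apply/negP => st; apply: h; exists t.
  have [ubI|nubI] := pselect (has_ubound I); last first.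
    exists (fun n => n%:R); split.
    - move=> n; apply: contrapT => nI; apply: nubI; exists n%:R => s Is.
      by rewrite leNgt; apply/negP => /ltW ns; apply/nI/(Idown _ _ ns).
    - by move=> m n mn; rewrite ler_nat.
    - by move=> s _; exists (Num.truncn s).+1; exact/ltW/truncnS_gt.
  have supI : has_sup I by [].
  exists (fun n => sup I - n.+1%:R^-1)%R; split.
  - move=> n; have [|s Is /ltW sn] := @sup_adherent _ _ (n.+1%:R^-1) _ supI; first by rewrite invr_gt0.
    exact: (Idown _ _ sn).
  - move=> m n mn; rewrite lerD2l lerN2 lef_pV2 ?posrE// ler_nat; exact: mn.
  - move=> s Is; have [t It st] := gtI s Is.
    have dp : (0 < sup I - s)%R by rewrite subr_gt0 (lt_le_trans st)// ub_le_sup.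
    exists (Num.truncn (sup I - s)^-1).
    rewrite lerBrDr -lerBrDl -[leRHS]invrK lef_pV2 ?posrE ?invr_gt0//.
    exact/ltW/truncnS_gt.
pose A n := [set y | (f y <= u n)%R].
have -> : [set x | P [set y | (f y <= f x)%R] < c%:E] = \bigcup_n A n.
  apply/seteqP; split => x /=; first by move=> /uI[n]; exists n.
  by move=> [n _ /= fx]; exact: (Idown _ _ fx).
have mA n : measurable (A n) by exact: ml.
have PA : P \o A @ \oo --> P (\bigcup_n A n).
  apply: nondecreasing_cvg_mu => //; first exact: bigcup_measurable.
  by move=> m n mn; apply/subsetPset => y /= /le_trans; apply; exact: ndu.
(* Each [A n] has mass below [c]; in the limit only the weak inequality survives. *)
rewrite -(cvg_lim _ PA)//; apply: lime_le; first by apply/cvg_ex; eexists; exact: PA.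
by near=> n; exact/ltW/Iu.
Unshelve. all: by end_near. Qed.
End below_level.

(** * Sections of measurable sets and product measures *)

Section sections_below.
Local Open Scope ereal_scope.
Context d1 d2 (T : measurableType d1) (V : measurableType d2) (R : realType)
  (P : probability V R).

(** The condition bounds the mass of the [z]-section of the measurable set [W], and section masses
    are measurable functions of [z]. *)
Lemma measurable_below_level (a : T * V -> R) (c : R) : measurable_fun setT a ->
  measurable [set z : T * V | P [set y | (a (z.1, y) <= a z)%R] < c%:E].
Proof.
move=> ma.
pose W := [set t : (T * V) * V | (a (t.1.1, t.2) <= a t.1)%R].
have mW : measurable W.
  rewrite (_ : W = (fun t : (T * V) * V => a (t.1.1, t.2) <= a t.1)%R @^-1` [set true]); last by apply/seteqP; split.
  rewrite -[X in measurable X]setTI.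
  apply: (measurable_fun_ler (f := fun t : (T * V) * V => a (t.1.1, t.2))) => //.
  - apply: (measurableT_comp ma); apply: measurable_fun_pair => //.
    exact: measurableT_comp.
  - exact: measurableT_comp.
have := measurable_fun_xsection P mW.
move=> /(_ measurableT `]-oo, c%:E[%classic (emeasurable_itv _)); rewrite setTI.
congr (measurable _); apply/seteqP; split => z; rewrite /= in_itv /=;
  rewrite (_ : xsection W z = [set y | (a (z.1, y) <= a z)%R]) //;
  by apply/seteqP; split => y; rewrite /xsection /= in_setE.
Qed.

(** Independence makes the law of [(X, Y)] the product of the law of [X] and [P]; the right side is
    then the integral over [C] of section masses of [H], each at least [c]. *)
Lemma product_ge_sections d0 (Omega : measurableType d0) (Q : probability Omega R)
    (X : Omega -> T) (Y : Omega -> V) (C : set T) (H : set (T * V)) (c : R) :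
  measurable_fun setT X -> measurable_fun setT Y ->
  (forall A B, measurable A -> measurable B ->
    Q (X @^-1` A `&` Y @^-1` B) = Q (X @^-1` A) * P B) ->
  measurable C -> measurable H -> (0 <= c)%R ->
  (forall t, C t -> c%:E <= P (xsection H t)) ->
  c%:E * Q (X @^-1` C) <= Q (X @^-1` C `&` [set w | H (X w, Y w)]).
Proof.
move=> mX mY XY mC mH c0 cH.
have mXY : measurable_fun setT (fun w => (X w, Y w)) by exact: measurable_fun_pair.
pose QX : probability T R := distribution Q (mfun_Sub (mem_set mX)).
pose QXY : probability (T * V)%type R := distribution Q (mfun_Sub (mem_set mXY)).
have QXYE A B : measurable A -> measurable B -> QXY (A `*` B) = QX A * P B.
  by move=> mA mB; rewrite -[RHS]XY.
have mCH : measurable ((C `*` setT) `&` H).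
  by apply: measurableI => //; exact: measurableX.
have -> : Q (X @^-1` C `&` [set w | H (X w, Y w)]) = (QX \x P) ((C `*` setT) `&` H).
  rewrite (product_measure_unique QXYE mCH).
  rewrite (_ : X @^-1` C `&` _ = (fun w => (X w, Y w)) @^-1` ((C `*` setT) `&` H)) //.
  by apply/seteqP; split => w /=; [move=> []|move=> [[]]].
rewrite /product_measure1.
have -> : c%:E * Q (X @^-1` C) = \int[QX]_t (c * \1_C t)%:E.
  rewrite (_ : (fun t => _) = (fun t => c%:E * (\1_C t)%:E)) //.
  rewrite ge0_integralZl//; last exact/measurable_EFinP.
  rewrite integral_indic// setIT //.
apply: ge0_le_integral => //.
- by move=> t _; rewrite lee_fin mulr_ge0.
- by apply/measurable_EFinP; exact: measurable_funM.
- exact: measurable_fun_xsection.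
- move=> t _; rewrite indicE; have [/set_mem Ct|_] := boolP (t \in C); rewrite ?mulr0 ?mulr1 //.
  rewrite /= (_ : xsection _ t = xsection H t); first exact: cH.
  apply/seteqP; split => y; rewrite /xsection /= !in_setE //=; by case.
Qed.
End sections_below.

(** * Independence of one observation from all the others *)

Section independence.
Local Open Scope ereal_scope.
Context d1 d2 (Omega : measurableType d1) (V : measurableType d2) (R : realType)
  (Q : probability Omega R) (N : nat) (e : 'I_N -> Omega -> V).
Hypothesis me : forall i, measurable_fun setT (e i).
Hypothesis prode : forall Bs : 'I_N -> set V, (forall i, measurable (Bs i)) ->
  Q (\bigcap_(i in [set: 'I_N]) (e i @^-1` Bs i)) = \prod_(i < N) Q (e i @^-1` Bs i).

(** The condition at [l] is trivial, so these product events generate the information carried by all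
    the data except [e l]. *)
Definition cylinders (l : 'I_N) : set (set Omega) :=
  [set C | exists Bs : 'I_N -> set V, [/\ forall i, measurable (Bs i), Bs l = setT &
     C = \bigcap_(i in [set: 'I_N]) (e i @^-1` Bs i)]].

Let mpre i B : measurable B -> measurable (e i @^-1` B).
Proof. by move=> mB; rewrite -[X in measurable X]setTI; exact: me. Qed.

Lemma measurable_cylinders l : cylinders l `<=` measurable.
Proof.
move=> _ [Bs [mBs _ ->]]; apply: fin_bigcap_measurable => // i _.
exact: mpre.
Qed.

Lemma measurable_fun_cylinders l i : i != l ->
  @measurable_fun _ _ (g_sigma_algebraType (cylinders l)) V setT (e i).
Proof.
move=> il _ B mB; rewrite setTI; apply: sub_sigma_algebra.
exists (fun i' => if i' == i then B else setT); split => [i'||].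
- by case: ifP.
- by rewrite eq_sym (negbTE il).
- apply/seteqP; split => w /= => [Bw i' _|/(_ i I)]; last by rewrite eqxx.
  by case: ifPn => // /eqP ->.
Qed.

(** Pi-lambda argument: cylinders are stable under intersection, and the events independent of [e l]
    landing in [B] form a lambda-system containing them. *)
Lemma cylinders_indep l C B : <<s cylinders l>> C -> measurable B ->
  Q (C `&` e l @^-1` B) = Q C * Q (e l @^-1` B).
Proof.
move=> sC mB; have mY := mpre l mB.
suff : <<s cylinders l>> `<=`
    [set C | measurable C /\ Q (C `&` e l @^-1` B) = Q C * Q (e l @^-1` B)].
  by move=> /(_ _ sC)[].
apply: lambda_system_subset => //.
- move=> _ _ [As [mA Al ->]] [Bs [mBs Bl ->]].
  exists (fun i => As i `&` Bs i); split => [i||].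
  + exact: measurableI.
  + by rewrite Al Bl setTI.
  + by rewrite -bigcapI; apply: eq_bigcapr => i _; rewrite preimage_setI.
- split => //.
  + by split => //; rewrite setTI probability_setT mul1e.
  (* Proper differences: all the probabilities are finite, so they can be subtracted. *)
  + move=> A D DA [mA QA] [mD QD]; split; first exact: measurableD.
    have fQ X : measurable X -> Q X < +oo by move=> mX; rewrite ltey_eq fin_num_measure.
    have mAY : measurable (A `&` e l @^-1` B) by exact: measurableI.
    have QD' X : measurable X -> D `&` X `<=` A `&` X ->
        Q (A `&` X `\` (D `&` X)) = Q (A `&` X) - Q (D `&` X).
      move=> mX DXA; rewrite measureD ?(setIidr DXA) //; try exact: measurableI.
      exact/fQ/measurableI.
    have /QD' : measurable [set: Omega] by [].
    rewrite !setIT => /(_ DA) ->.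
    have -> : (A `\` D) `&` e l @^-1` B = A `&` e l @^-1` B `\` (D `&` e l @^-1` B).
      by apply/seteqP; split => w /=; tauto.
    rewrite QD' //; last exact: setSI.
    rewrite QA QD muleBl // ?fin_num_measure//.
    by rewrite fin_num_adde_defr// fin_num_measure.
  + move=> F ndF FH; have mF n : measurable (F n) by case: (FH n).
    have mUF : measurable (\bigcup_n F n) by exact: bigcup_measurable.
    split => //; rewrite setI_bigcupl.
    have h1 : (Q \o (fun n => F n `&` e l @^-1` B)) @ \oo --> Q (\bigcup_n (F n `&` e l @^-1` B)).
      apply: nondecreasing_cvg_mu.
      - by move=> n; exact: measurableI.
      - by apply: bigcup_measurable => n _; exact: measurableI.
      - by move=> m n mn; apply/subsetPset; apply: setSI; apply/subsetPset/ndF.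
    have h2 : (fun n => Q (F n) * Q (e l @^-1` B)) @ \oo --> Q (\bigcup_n F n) * Q (e l @^-1` B).
      apply: cvgeZr; first by rewrite fin_num_measure.
      exact: nondecreasing_cvg_mu.
    rewrite -(cvg_lim _ h1)// -(cvg_lim _ h2)//; congr (limn _); apply/funext => n /=.
    by case: (FH n).
- move=> _ [Bs [mBs Bl ->]]; split.
    by apply: (@measurable_cylinders l); exists Bs; split.
  (* Filling the free coordinate [l] with [B] gives another product event, so [prode] computes both
     sides. *)
  pose Cs i := if i == l then B else Bs i.
  transitivity (Q (\bigcap_(i in [set: 'I_N]) (e i @^-1` Cs i))).
    congr (Q _); apply/seteqP; split => w /=.
      by move=> [h hB] i _; rewrite /Cs; case: ifPn => [/eqP ->|_] //; exact: h.
    move=> h; split; last by have := h l I; rewrite /= /Cs eqxx.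
    move=> i _; have := h i I; rewrite /= /Cs; case: ifPn => // /eqP -> _.
    by rewrite /= Bl.
  rewrite !prode //; last by move=> i; rewrite /Cs; case: ifP.
  rewrite (bigD1 l) //= [in RHS](bigD1 l) //= Bl preimage_setT probability_setT mul1e.
  rewrite /Cs eqxx muleC; congr (_ * _); apply: eq_bigr => i /negbTE -> //.
Qed.
End independence.

(** * Order statistics *)

Section order_statistic.
Context (R : realType).

(** In sorted order the first [k] entries are at most the one at index [k.-1]; ties can only raise
    the count. *)
Lemma kth_smallest_count (s : seq R) k : (0 < k <= size s)%N ->
  (k <= count (fun x => x <= kth_smallest s k)%R s)%N.
Proof.
case: k => // k /= ks; rewrite -(count_sort <=%R).
set t := sort _ s; have st : size t = size s by rewrite size_sort.
rewrite -(cat_take_drop k.+1 t) count_cat.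
have szt : size (take k.+1 t) = k.+1 by rewrite size_takel ?st.
have /eqP -> : count (fun x => x <= kth_smallest s k.+1) (take k.+1 t) == k.+1.
  rewrite -[X in _ == X]szt -all_count.
  apply/(all_nthP 0) => i; rewrite szt ltnS => ik.
  rewrite nth_take ?ltnS// /kth_smallest /= -/t.
  apply: (le_sorted_leq_nth 0 (sort_le_sorted s)) => //; rewrite !inE st //.
  exact: leq_ltn_trans ks.
exact: leq_addr.
Qed.

Local Open Scope ereal_scope.
(** If the sublevel set at the k-th smallest score had mass below [c], so would the smaller sublevel
    sets of the at least [k] points scoring no more, and the count would reach [k]. *)
Lemma probability_kth_smallest d0 (V : measurableType d0) (P : probability V R)
    (I : Type) (f : V -> R) (x : I -> V) (s : seq I) (k : nat) (c : R) :
  measurable_fun setT f -> (0 < k <= size s)%N ->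
  (count (fun j => `[< (P [set y | (f y <= f (x j))%R] < c%:E)%E >]) s < k)%N ->
  c%:E <= P [set y | (f y <= kth_smallest [seq f (x j) | j <- s] k)%R].
Proof.
move=> mf ks; rewrite ltnNge => /negP ct; rewrite leNgt; apply/negP => Pc; apply: ct.
have := @kth_smallest_count [seq f (x j) | j <- s] k; rewrite size_map => /(_ ks).
rewrite count_map => /leq_trans; apply; apply: sub_count => j /= fj.
have ml t := measurable_sublevel t mf.
apply/asboolP; apply: le_lt_trans Pc; apply: le_measure; rewrite ?inE//.
by move=> y /= /le_trans; apply.
Qed.
End order_statistic.

(** * Coverage of the data-driven ellipsoid *)

Section coverage.
Local Open Scope ereal_scope.
Context (R : realType) (d : nat) (P : probability (borelV R d) R) (eps : R)
  (d0 : measure_display) (Omega : measurableType d0) (Q : probability Omega R)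
  (N : nat) (e : 'I_N -> Omega -> 'cV[R]_d) (e_iid : iid_with Q e P)
  (N1 N2 : nat) (i1 : 'I_N1 -> 'I_N) (i2 : 'I_N2 -> 'I_N).

Let mu w := smean (fun n => e (i1 n) w).
Let Sigma w := scov (fun n => e (i1 n) w).

(* The low points of the header, as a set of pairs (outcome, point). *)
Definition undercovers : set (Omega * borelV R d) := [set z |
  P [set y | (mahal (mu z.1) (Sigma z.1) y <= mahal (mu z.1) (Sigma z.1) z.2)%R] < (1 - eps)%:E].

Lemma measurable_mahal_section w :
  @measurable_fun _ _ (borelV R d) R setT (mahal (mu w) (Sigma w)).
Proof.
apply: measurable_mahal; [by move=> i j..|].
exact: (@mx_measurableP _ (borelV R d) R d id).
Qed.

(** The map [h], an identity when applied, lets [T] be [Omega] with a coarser sigma-algebra: only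
    the first group has to be measurable for it. *)
Lemma measurable_undercovers d1 (T : measurableType d1) (h : T -> Omega) :
  (forall n, @measurable_fun _ _ T (borelV R d) setT (e (i1 n) \o h)) ->
  measurable [set z : T * borelV R d | undercovers (h z.1, z.2)].
Proof.
move=> me.
apply: (@measurable_below_level _ _ T (borelV R d) R P
  (fun z => mahal (mu (h z.1)) (Sigma (h z.1)) z.2) (1 - eps)).
have mfst n : mx_measurable (fun z : T * borelV R d => e (i1 n) (h z.1)).
  apply: mx_measurableP; exact: (measurableT_comp (me n)).
apply: measurable_mahal.
- exact: mx_measurable_smean.
- exact: mx_measurable_scov.
- by apply: mx_measurableP; exact: measurable_snd.
Qed.

Definition undercovering_sample (j : 'I_N2) : set Omega :=
  [set w | undercovers (w, e (i2 j) w)].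

Lemma measurable_undercovering_sample d1 (T : measurableType d1) (h : T -> Omega) j :
  (forall n, @measurable_fun _ _ T (borelV R d) setT (e (i1 n) \o h)) ->
  @measurable_fun _ _ T (borelV R d) setT (e (i2 j) \o h) ->
  measurable (h @^-1` undercovering_sample j).
Proof.
move=> m1 m2.
have mp : measurable_fun setT (fun t : T => (t, (e (i2 j) \o h) t : borelV R d)).
  exact: measurable_fun_pair.
by have := mp measurableT _ (measurable_undercovers m1); rewrite setTI.
Qed.

Hypothesis i2_inj : injective i2.
Hypothesis i12_disj : forall a b, i1 a != i2 b.
Hypothesis eps01 : (0 <= eps <= 1)%R.

(** Given all the data except the new point, the score and the count over [s] are fixed while the
    new point keeps law [P]; by [probability_below_level] it is low with probability at most
    [1 - eps]. *)
Lemma undercovering_sample_indep j s k : j \notin s ->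
  eps%:E * Q [set w | occurrences undercovering_sample s w = k] <=
  Q ([set w | occurrences undercovering_sample s w = k] `&` ~` undercovering_sample j).
Proof.
move=> js; have /andP[eps0 eps1] := eps01.
have [me [mP prod_e]] := e_iid.
(* [T] is [Omega] with the sigma-algebra of the other data; the identity into [T] is the variable
   independent of [e (i2 j)]. *)
pose T := g_sigma_algebraType (cylinders (V := borelV R d) e (i2 j)).
have meT i : i != i2 j -> @measurable_fun _ _ T (borelV R d) setT (e i).
  exact: measurable_fun_cylinders.
have mXT : @measurable_fun _ _ Omega T setT id.
  move=> _ B sB; rewrite setTI; move: B sB; apply: smallest_sub.
    exact: sigma_algebra_measurable.
  exact: (measurable_cylinders me).
pose H := ~` [set z : T * borelV R d | undercovers z].
have mH : measurable H.
  apply: measurableC; apply: (@measurable_undercovers _ T id) => n.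
  exact: meT.
(* The count is measurable for [T]: [j \notin s] and disjointness of the groups exclude [e (i2 j)]
   from what it reads. *)
pose C : set T := [set w | occurrences undercovering_sample s w = k].
have mC : measurable C.
  rewrite /C -[X in measurable X]setTI.
  apply: (@measurable_occurrences _ T _ _ s _ measurableT [set k]) => // i si.
  apply: (@measurable_undercovering_sample _ T id) => [n|]; first exact: meT.
  by apply: meT; apply: contraNneq js => /i2_inj <-.
apply: (@product_ge_sections _ _ T (borelV R d) R P _ Omega Q id (e (i2 j)) C H) => //.
  move=> A B mA mB; rewrite -(mP (i2 j)) //; exact: (cylinders_indep me prod_e).
move=> w _.
have mHw : measurable (xsection H w) by exact: measurable_xsection.
have : P (~` xsection H w) <= (1 - eps)%:E.
  rewrite (_ : ~` _ = [set x | undercovers (w, x)]).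
    apply: (@probability_below_level _ (borelV R d) R P (mahal (mu w) (Sigma w))); last by rewrite subr_ge0.
    exact: measurable_mahal_section.
  by apply/seteqP; split => x; rewrite /xsection /= in_setE /H /= ?notK// => h; apply: contrapT.
rewrite probability_setC //.
have -> : P (xsection H w) = (fine (P (xsection H w)))%:E by rewrite fineK// fin_num_measure.
by rewrite -EFinB !lee_fin; lra.
Qed.

(** The witness is the event of fewer than [k] low points, so its measurability is that of a
    count. *)
Lemma coverage k : (0 < k <= N2)%N ->
  exists Aev : set Omega, [/\ measurable Aev,
    (binom_sum N2 eps k)%:E <= Q Aev &
    forall w, Aev w -> (1 - eps)%:E <= P (ellipsoid (mu w) (Sigma w)
      (kth_smallest [seq mahal (mu w) (Sigma w) (e (i2 j) w) | j <- enum 'I_N2] k))].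
Proof.
move=> kN2; have [me [mP prod_e]] := e_iid.
exists [set w | (occurrences undercovering_sample (enum 'I_N2) w < k)%N].
have mB j : measurable (undercovering_sample j).
  by apply: (@measurable_undercovering_sample _ Omega id) => [n|]; exact: me.
split.
- rewrite -[X in measurable X]setTI.
  exact: (@measurable_occurrences _ Omega _ _ (enum 'I_N2) _ measurableT [set n | (n < k)%N]).
- rewrite -{1}(size_enum_ord N2); apply: binomial_tail => //.
    exact: undercovering_sample_indep.
  exact: enum_uniq.
- move=> w Aw; apply: (@probability_kth_smallest R _ (borelV R d) P 'I_N2).
  + exact: measurable_mahal_section.
  + by rewrite size_enum_ord.
  + exact: Aw.
Qed.
End coverage.

(** * Measurability of the second-stage value *)

Section second_stage.
Context (R : realType).

Lemma continuous_bigsum (T : topologicalType) I (s : seq I) (f : I -> T -> R) :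
  (forall i, continuous (f i)) -> continuous (fun x => \sum_(i <- s) f i x).
Proof.
move=> cf; elim: s => [|i s IH].
  by under eq_fun do rewrite big_nil; move=> x; exact: cvg_cst.
under eq_fun do rewrite big_cons.
by move=> x; apply: cvgD; [exact: cf|exact: IH].
Qed.

(** Tube lemma: if no point of the compact [C] is [Z]-related to [t], the same holds for all [t']
    near [t]. *)
Lemma closed_exists_compact (T K : topologicalType) (C : set K) (Z : set (T * K)) :
  compact C -> closed Z -> closed [set t | exists2 y, C y & Z (t, y)].
Proof.
move=> /compact_near_coveringP cC cZ; rewrite -openC openE => t /= nt.
suff : \forall t' \near t, C `<=` [set y | ~ Z (t', y)].
  by apply: filterS => t' h [y Cy Zy]; exact: (h y).
apply: cC => y Cy.
have : nbhs (t, y) (~` Z).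
  apply: open_nbhs_nbhs; split; first by rewrite openC.
  by move=> Zy; apply: nt; exists y.
case=> -[U W] /= [nU nW] UW; exists (W, U) => //= -[y' t'] /= [Wy Ut].
exact: (UW (t', y')).
Qed.

Context (p q d r : nat) (A : 'M[R]_(r, q)) (B : 'M[R]_(r, p)) (D : 'M[R]_(r, d))
  (E : 'cV[R]_r) (F : 'cV[R]_q) (uhat : 'cV[R]_d) (x : 'cV[R]_p).

(** The slack [n.+1%:R^-1] stands in for an attained infimum, and the bound [m] on the entries
    prepares a compact search set. Row vectors fit [rV_compact]. *)
Lemma Qval_leP (u : 'cV[R]_d) (eta : R) : (Qval A B D E F x u <= eta%:E)%E <->
  forall n : nat, exists m : nat, exists2 v : 'rV[R]_q,
    (forall i, `|v 0 i| <= m%:R) &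
    (colge (A *m v^T) (B *m x + D *m u + E) /\ (F^T *m v^T) 0 0 <= eta + n.+1%:R^-1).
Proof.
split.
  move=> h n.
  have : (Qval A B D E F x u < (eta + n.+1%:R^-1)%:E)%E.
    by apply: (le_lt_trans h); rewrite lte_fin ltrDl invr_gt0.
  move=> /ereal_inf_lt[_ [y Yy <-]]; rewrite lte_fin => /ltW yle.
  (* An integer above the sum of the absolute entries bounds each of them. *)
  exists (Num.truncn (\sum_i `|y i 0|)).+1; exists y^T; last by rewrite trmxK.
  move=> i; rewrite mxE; apply: le_trans (ltW (truncnS_gt _)).
  by rewrite (bigD1 i) //= lerDl sumr_ge0.
move=> h; apply/lee_addgt0Pr => eps eps0.
have [m [v _ [Yv vle]]] := h (Num.truncn eps^-1).
apply: (@le_trans _ _ ((F^T *m v^T) 0 0)%:E).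
  by apply: ereal_inf_lbound; exists v^T.
rewrite -EFinD lee_fin (le_trans vle)// lerD2l.
rewrite -[leRHS]invrK lef_pV2 ?posrE ?invr_gt0//.
exact/ltW/truncnS_gt.
Qed.

(* Bounding the second-stage variable by m makes it range over a compact set, along
   which the projection of a closed set is closed; hence no Fourier-Motzkin. *)
Lemma measurable_Qval_le eta : @measurable _ (borelV R d)
  [set u : 'cV[R]_d | (Qval A B D E F x (uhat + u) <= eta%:E)%E].
Proof.
pose Z n : set ('cV[R]_d * 'rV[R]_q) := [set z |
  colge (A *m z.2^T) (B *m x + D *m (uhat + z.1) + E) /\ (F^T *m z.2^T) 0 0 <= eta + n.+1%:R^-1].
pose K m : set 'rV[R]_q := [set v | forall i, `|v 0 i| <= m%:R].
rewrite (_ : [set u | _] = \bigcap_n \bigcup_m [set u | exists2 v, K m v & Z n (u, v)]); last first.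
  apply/seteqP; split => u /=.
    by move=> /Qval_leP h n _; have [m mv] := h n; exists m.
  by move=> h; apply/Qval_leP => n; have [m _ mv] := h n I; exists m.
apply: bigcapT_measurable => n; apply: bigcupT_measurable => m.
(* The generators are the open sets, so the closed set is reached through its complement. *)
rewrite -[X in measurable X]setCK; apply: measurableC; apply: sub_sigma_algebra.
rewrite /vopen /= openC; apply: closed_exists_compact.
  apply: (@rV_compact R q (fun i => [set z | `|z| <= m%:R])) => i.
  rewrite (_ : [set _ | _] = `[- m%:R, m%:R]%classic); first exact: segment_compact.
  by apply/seteqP; split => z; rewrite /= in_itv /= ler_norml.
have c1 i : continuous (fun z : 'cV[R]_d * 'rV[R]_q => z.1 i 0).
  move=> z; apply: (@continuous_comp _ _ _ fst (fun M : 'cV[R]_d => M i 0)); first exact: cvg_fst.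
  exact: coord_continuous.
have c2 i : continuous (fun z : 'cV[R]_d * 'rV[R]_q => z.2 0 i).
  move=> z; apply: (@continuous_comp _ _ _ snd (fun M : 'rV[R]_q => M 0 i)); first exact: cvg_snd.
  exact: coord_continuous.
have cl (f g : 'cV[R]_d * 'rV[R]_q -> R) : continuous f -> continuous g -> closed [set z | f z <= g z].
  move=> cf cg; rewrite (_ : [set _ | _] = (g \- f) @^-1` [set z | 0 <= z]).
    by apply: preimage_closed; [move=> z _; apply: cvgB; [exact: cg|exact: cf]|exact: closed_ge].
  by apply/seteqP; split => z; rewrite /= subr_ge0.
have cmul l (M : 'M[R]_(l, q)) i : continuous (fun z : 'cV[R]_d * 'rV[R]_q => (M *m z.2^T) i 0).
  under eq_fun do rewrite mxE.
  apply: continuous_bigsum => j z; under eq_fun do rewrite mxE.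
  by apply: cvgMl_tmp; exact: c2.
rewrite (_ : Z n = (\bigcap_i [set z | (B *m x + D *m (uhat + z.1) + E) i 0 <= (A *m z.2^T) i 0]) `&`
   [set z | (F^T *m z.2^T) 0 0 <= eta + n.+1%:R^-1]).
  apply: closedI; last by apply: cl => // z; exact: cvg_cst.
  apply: closed_bigI => i _; apply: cl => //.
  have -> : (fun z : 'cV[R]_d * 'rV[R]_q => (B *m x + D *m (uhat + z.1) + E) i 0) =
      (fun z => (B *m x) i 0 + \sum_j D i j * (uhat j 0 + z.1 j 0) + E i 0).
    by apply/funext => z; rewrite !mxE; congr (_ + _ + _); apply: eq_bigr => j _; rewrite mxE.
  move=> z; apply: cvgD; last exact: cvg_cst.
  apply: cvgD; first exact: cvg_cst.
  apply: continuous_bigsum => j {}z; apply: cvgMl_tmp; apply: cvgD; first exact: cvg_cst.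
  exact: c1.
by apply/seteqP; split => z /= [h1 h2]; split => // i; [move=> _; exact: h1|exact: h1].
Qed.

Lemma measurable_box (Ulo Uhi : 'cV[R]_d) : @measurable _ (borelV R d)
  [set u : 'cV[R]_d | box Ulo Uhi (uhat + u)].
Proof.
have mi (i : 'I_d) : @measurable_fun _ _ (borelV R d) R setT (fun u : 'cV[R]_d => uhat i 0 + u i 0).
  apply: measurable_funD => //.
  exact: (@mx_measurableP _ (borelV R d) R d id).
rewrite (_ : [set u | _] = \bigcap_(i in [set: 'I_d])
  ((fun u : 'cV[R]_d => uhat i 0 + u i 0) @^-1` `[Ulo i 0, Uhi i 0]%classic)).
  apply: fin_bigcap_measurable => // i _.
  by rewrite -[X in measurable X]setTI; exact: mi.
apply/seteqP; split => u /=.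
  by move=> [h1 h2] i _; have := h1 i; have := h2 i; rewrite /= in_itv /= mxE => -> ->.
by move=> h; split => i; rewrite mxE; have := h i I; rewrite /= in_itv /= => /andP[].
Qed.
End second_stage.

(** [k] is positive because the empty sum 0 is below [1 - delta]. By [binom_sum_full], [N] qualifies
    once [(1 - eps) ^+ N <= delta], which is the size hypothesis after taking logarithms and
    dividing by the negative [ln (1 - eps)]. *)
Lemma order_index_bounds (R : realType) (eps delta : R) (N k : nat) :
  0 < eps < 1 -> 0 < delta < 1 -> ln delta / ln (1 - eps) <= N%:R ->
  is_min_nat (fun n => 1 - delta <= binom_sum N eps n) k -> (0 < k <= N)%N.
Proof.
move=> /andP[eps0 eps1] /andP[delta0 delta1] hN [hk mink]; apply/andP; split.
  case: k hk {mink} => // ; rewrite /binom_sum big_ord0; lra.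
apply: mink; rewrite binom_sum_full lerD2l lerN2.
have q0 : 0 < 1 - eps by rewrite subr_gt0.
rewrite -ler_ln ?posrE ?exprn_gt0// lnXn// -mulr_natl.
by rewrite -ler_ndivrMr// ln_lt0// q0 /= gtrBl.
Qed.

(** * Comparison of the optimal values *)

Section values.
Local Open Scope ereal_scope.
Context (R : realType) (p q d r : nat) (A : 'M[R]_(r, q)) (B : 'M[R]_(r, p))
  (C : 'cV[R]_p) (D : 'M[R]_(r, d)) (E : 'cV[R]_r) (F : 'cV[R]_q)
  (uhat : 'cV[R]_d) (P : probability (borelV R d) R) (eps : R).

Lemma O_cc_le_O_x (X : set 'cV[R]_p) x : X x ->
  O_cc X A B C D E F uhat P eps <= O_x A B C D E F uhat P eps x.
Proof.
move=> Xx; rewrite /O_x -leeBlDl//; apply: le_ereal_inf_tmp => _ [eta ok <-].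
rewrite leeBlDl// -EFinD; apply: ereal_inf_lbound.
by exists x, eta.
Qed.

(** Up to a null set every error in [S] gives a load in the uncertainty set, so any real [eta] above
    the worst case is met with probability at least [P S]. *)
Lemma O_x_le_worst_case (Ulo Uhi : 'cV[R]_d) (S : set 'cV[R]_d) x :
  P [set e : 'cV[R]_d | box Ulo Uhi (uhat + e)%R] = 1 ->
  @measurable _ (borelV R d) S -> (1 - eps)%:E <= P S ->
  O_x A B C D E F uhat P eps x <= (fcost C x)%:E +
    ereal_sup [set Qval A B D E F x u | u in [set u | box Ulo Uhi u /\ S (u - uhat)%R]].
Proof.
move=> P1 mS PS; rewrite /O_x leeD2l//.
set M := ereal_sup _.
have ok eta : M <= eta%:E -> chance_ok A B D E F uhat P eps x eta.
  move=> Meta; apply: (le_trans PS).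
  pose K : set (borelV R d) := [set e : 'cV[R]_d | box Ulo Uhi (uhat + e)%R].
  have mK : measurable K by exact: measurable_box.
  have PK0 : P (~` K) = 0 by rewrite probability_setC// P1 subee.
  have mQ := measurable_Qval_le A B D E F uhat x eta.
  apply: (@le_trans _ _ (P ([set e : 'cV[R]_d | Qval A B D E F x (uhat + e)%R <= eta%:E] `|` ~` K))).
    apply: le_measure; rewrite ?inE//; first by apply: measurableU => //; exact: measurableC.
    move=> e Se; have [Ke|] := pselect (K e); [left|by right].
    apply: le_trans Meta; apply: ereal_sup_ubound; exists (uhat + e)%R => //; split => //.
    by rewrite addrAC subrr add0r.
  rewrite -[leRHS]adde0 -PK0; apply: measureU2 => //; exact: measurableC.
(* A finite [M] is itself a feasible [eta], and an infinite upper bound is trivial. If [M] is minus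
   infinity, every real [eta] is feasible and the infimum must be shown to be minus infinity too. *)
case: (M) ok => [t| |] ok; rewrite ?leey//.
  by apply: ereal_inf_lbound; exists t => //; exact: ok.
have : forall eta, ereal_inf [set eta%:E | eta in
    [set eta | chance_ok A B D E F uhat P eps x eta]] <= eta%:E.
  by move=> eta; apply: ereal_inf_lbound; exists eta => //; apply: ok; rewrite leNye.
(* A finite infimum [t] would be at most [t - 1], and plus infinity at most 0. *)
case: ereal_inf => [t /(_ (t - 1)%R)|/(_ 0%R)|] //.
by rewrite lee_fin lerBrDr gerDl ler10.
Qed.
End values.

Theorem theorem1
  (R : realType)
  (* dimensions: x in R^p, y in R^q, u,e in R^d, r coupling constraints,
     s linear constraints defining the pre-dispatch set X *)
  (p q d r s : nat)
  (* mixed-integer linear pre-dispatch feasible set X *)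
  (G : 'M[R]_(s, p)) (g : 'cV[R]_s) (J : set 'I_p)
  (A : 'M[R]_(r, q)) (B : 'M[R]_(r, p)) (C : 'cV[R]_p) (D : 'M[R]_(r, d))
  (E : 'cV[R]_r) (F : 'cV[R]_q)
  (uhat Ulo Uhi : 'cV[R]_d)
  (* distribution P of the forecast error: continuous (no atoms) *)
  (P : probability (borelV R d) R)
  (P_cont : forall v : 'cV[R]_d, P [set v] = 0%E)
  (P_U0 : P [set e : 'cV[R]_d | box Ulo Uhi (uhat + e)] = 1%E)
  (eps delta : R) (eps01 : 0 < eps < 1) (delta01 : 0 < delta < 1)
  (* historical data e_1..e_N, i.i.d. with distribution P *)
  (d0 : measure_display) (Omega : measurableType d0) (Qm : probability Omega R)
  (N : nat) (e : 'I_N -> Omega -> 'cV[R]_d) (e_iid : iid_with Qm e P)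
  (* two disjoint groups *)
  (N1 N2 : nat) (i1 : 'I_N1 -> 'I_N) (i2 : 'I_N2 -> 'I_N)
  (i1_inj : injective i1) (i2_inj : injective i2)
  (i12_disj : forall a b, i1 a != i2 b)
  (hN12 : (N1 + N2 <= N)%N)
  (hN2 : ln delta / ln (1 - eps) <= N2%:R)
  (* Sigma is (almost surely) invertible *)
  (Sigma_inv : {ae Qm, forall w, scov (fun n => e (i1 n) w) \in unitmx})
  (* k = n*_{N2} *)
  (k : nat) (hk : is_min_nat (fun n => 1 - delta <= binom_sum N2 eps n) k) :
  let mu w := smean (fun n => e (i1 n) w) in
  let Sigma w := scov (fun n => e (i1 n) w) in
  let alpha w := kth_smallest
       [seq mahal (mu w) (Sigma w) (e (i2 j) w) | j <- enum 'I_N2] k in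
  let Eset w := ellipsoid (mu w) (Sigma w) (alpha w) in
  let X := milp_set G g J in
  let U1 w := [set u | box Ulo Uhi u /\ Eset w (u - uhat)] in
  (exists Aev : set Omega, measurable Aev /\ (Qm Aev >= (1 - delta)%:E)%E /\
     forall w, Aev w -> (P (Eset w) >= (1 - eps)%:E)%E)
  /\
  (forall x0 : Omega -> 'cV[R]_p,
     (forall w, X (x0 w) /\
        ((fcost C (x0 w))%:E
         + ereal_sup [set Qval A B D E F (x0 w) u | u in U1 w])%E
        = O_rob X A B C D E F (U1 w)) ->
     exists Aev : set Omega, measurable Aev /\ (Qm Aev >= (1 - delta)%:E)%E /\
       forall w, Aev w ->
         (O_cc X A B C D E F uhat P eps <= O_x A B C D E F uhat P eps (x0 w))%E /\
         (O_x A B C D E F uhat P eps (x0 w) <= O_rob X A B C D E F (U1 w))%E).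
Proof.
move=> mu Sigma alpha Eset X U1.
have [eps0 eps1] := andP eps01.
have kN2 := order_index_bounds eps01 delta01 hN2 hk.
have eps01' : 0 <= eps <= 1 by rewrite !ltW.
have [Aev [mA QA AE]] := coverage e_iid i2_inj i12_disj eps01' kN2.
have QA' : (Qm Aev >= (1 - delta)%:E)%E.
  by apply: le_trans QA; rewrite lee_fin; case: hk.
split; first by exists Aev.
(* The same event serves both claims: once the ellipsoid covers, the value inequalities are
   deterministic. *)
move=> x0 x0opt; exists Aev; split => //; split => // w Aw.
have [Xx <-] := x0opt w; split; first exact: O_cc_le_O_x.
apply: O_x_le_worst_case => //; last exact: AE.
exact: (@measurable_sublevel _ (borelV R d) _ _ (alpha w)
  (@measurable_mahal_section R d _ _ _ e _ i1 w)).
Qed.
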